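(* Fix $j\ge0$. For each $f\in\mathcal{L}_j$ one has $\underline{\sigma}_jf=\overline{\sigma}_jf=\overline{I}_jf$ a.e., and so $\mathcal{L}_j\subseteq\mathcal{L}^+_{\overline{\sigma}_j}$.
   Context: Setting. Fix $s_0\in\mathbb{R}$ and a trajectory set $\mathcal{S}$, i.e. a (nonempty) set of real sequences $S=(S_i)_{i\ge0}$ with $S_0=s_0$. For $S\in\mathcal{S}$ and $j\ge0$ let $\mathcal{S}_{(S,j)}=\{\tilde S\in\mathcal{S}:\tilde S_i=S_i,\ 0\le i\le j\}$; the pair $(S,j)$ is called a node. Put $\Delta_iS=S_{i+1}-S_i$. For every node a set $\mathcal{H}_{(S,j)}$ of portfolios is given (depending only on the node, i.e. $\mathcal H_{(\tilde S,j)}=\mathcal H_{(S,j)}$ if $\tilde S\in\mathcal S_{(S,j)}$): its elements are sequences $H=(H_i)_{i\ge j}$ of functions $H_i:\mathcal{S}_{(S,j)}\to\mathbb{R}$ that are non-anticipative, i.e. $H_i(\tilde S)=H_i(\hat S)$ whenever $\tilde S_k=\hat S_k$ for $j\le k\le i$. The following is assumed: (H.1) $\alpha\mathcal{H}_{(S,j)}+\mathcal{H}_{(S,j)}\subseteq\mathcal{H}_{(S,j)}$ for all $\alpha\ge0$; (H.2) every $(H_i)_{i\ge j}$ with each $H_i$ constant on $\mathcal{S}_{(S,j)}$ with value $-1$, $0$ or $1$ belongs to $\mathcal{H}_{(S,j)}$; (H.3) if $(H_i)_{i\ge j}\in\mathcal{H}_{(S,j)}$ and $k\ge j$ then $(H_i|_{\mathcal{S}_{(S,k)}})_{i\ge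 k}\in\mathcal{H}_{(S,k)}$; (H.4) if $(H_i)_{i\ge j}\in\mathcal{H}_{(S,j)}$, $k\ge j$, $G_i=H_i$ for $j\le i\le k$ and $G_i=0$ for $i>k$, then $G\in\mathcal{H}_{(S,j)}$. Elementary functions. For $V\in\mathbb{R}$, $H\in\mathcal{H}_{(S,j)}$, $n\ge j$ let $\Pi^{V,H}_{j,n}(\tilde S)=V+\sum_{i=j}^{n-1}H_i(\tilde S)\Delta_i\tilde S$ for $\tilde S\in\mathcal{S}_{(S,j)}$; $\mathcal{D}_{(S,j)}$ is the set of all such functions, $\mathcal{D}_{(S,j)}^+$ its non-negative elements, $\mathcal{D}_{(S,j)}^-=-\mathcal{D}_{(S,j)}^+$. $\mathcal{D}_j$ is the set of $f:\mathcal{S}\to\mathbb{R}$ with $f|_{\mathcal{S}_{(S,j)}}\in\mathcal{D}_{(S,j)}$ for all $S\in\mathcal{S}$; $\mathcal{D}_j^+$ its non-negative elements. Standing assumption 1 (local $0$-neutrality): $\sup_{\tilde S\in\mathcal{S}_{(S,j)}}(\tilde S_{j+1}-S_j)\ge0\ge\inf_{\tilde S\in\mathcal{S}_{(S,j)}}(\tilde S_{j+1}-S_j)$ at every node. Then $I_jf(S)=V$ for $f\in\mathcal{D}_j^+$ with $f|_{\mathcal{S}_{(S,j)}}=\Pi^{V,H}_{j,n}$ is well defined. Norm and a.e. $Q$ is the set of functions $\mathcal{S}\to[-\infty,\infty]$, $P\subseteq Q$ the non-negative ones. Conventions: $0\cdot\infty=0$, $\infty+(-\infty)=\infty$, $u-v=u+(-v)$,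 $\inf\emptyset=\infty$. For $f\in P$, $\overline{I}_jf(S)=\inf\{\sum_{m\ge1}V^m: f\le\sum_{m\ge1}f_m\text{ on }\mathcal{S}_{(S,j)},\ f_m=\Pi^{V^m,H^m}_{j,n_m}\in\mathcal{D}_{(S,j)}^+\}$; for $f\in Q$, $\|f\|_j(S)=\overline{I}_j|f|(S)$ and $\|f\|=\|f\|_0$ (a constant). $E\subseteq\mathcal{S}$ is null if $\|\mathbf{1}_E\|=0$; ''a.e.'' means off a null set. A property holds a.e. on $\mathcal{S}_{(S,j)}$ if the set $E$ of points of $\mathcal{S}_{(S,j)}$ where it fails satisfies $\|\mathbf{1}_E\|_j(S)=0$. Conditional integral. For $f\in Q$, $\overline{\sigma}_jf(S)=\inf\{\sum_{m\ge0}V^m: f\le\sum_{m\ge0}f_m\text{ on }\mathcal{S}_{(S,j)},\ f_0=\Pi^{V^0,H^0}_{j,n_0}\in\mathcal{D}_{(S,j)}^-,\ f_m=\Pi^{V^m,H^m}_{j,n_m}\in\mathcal{D}_{(S,j)}^+\ (m\ge1)\}$ (for $f_0\in\mathcal D_{(S,j)}^-=-\mathcal D_{(S,j)}^+$, $H^0$ is the negative of a portfolio and $V^0=-I_j(-f_0)(S)$), and $\underline{\sigma}_jf=-\overline{\sigma}_j(-f)$. Standing assumption 2: $\overline{\sigma}_j0=0$ on $\mathcal{S}$ for all $j\ge0$. $\mathcal{L}_{\overline{\sigma}_j}=\{f\in Q:\overline{\sigma}_jf-\underline{\sigma}_jf=0\text{ a.e.}\}$, and $\mathcal{L}^+_{\overline{\sigma}_j}$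 is the set of its non-negative elements. Classes. $\mathcal{M}_j(S)$ is the set of $v=\sum_{m\ge1}f_m$ with $f_m\in\mathcal{D}_j^+$ and $\sum_mI_jf_m(S)<\infty$. $\mathcal{L}_j$ is the set of $f:\mathcal{S}\to[0,\infty]$ such that for a.e. $S\in\mathcal{S}$: for all $\epsilon>0$ there are $u,v\in\mathcal{M}_j(S)$ with $f=v-u$ a.e. on $\mathcal{S}_{(S,j)}$ and $\overline{I}_ju(S)\le\epsilon$. *)

(* Defs.v *)
From mathcomp Require Import all_boot all_order all_algebra.
From mathcomp Require Import all_classical all_reals all_analysis.
Set Implicit Arguments.
Unset Strict Implicit.
Unset Printing Implicit Defensive.
Import Order.TTheory GRing.Theory Num.Theory.
Import numFieldNormedType.Exports.

Local Open Scope classical_set_scope.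
Local Open Scope ring_scope.

(* The trajectory set is T : set (nat -> R); points of the type T are the
   trajectories, and functions on the trajectory set have domain the type T. *)
Section Trajectories.
Context {R : realType} {T : set (nat -> R)}.

Definition node (S : T) (j : nat) : set T :=
  [set S' | forall i, (i <= j)%N -> val S' i = val S i].

Definition locally_neutral : Prop := forall (S : T) (j : nat),
  (0 <= ereal_sup [set (val S' j.+1 - val S j)%:E | S' in node S j])%E /\
  (ereal_inf [set (val S' j.+1 - val S j)%:E | S' in node S j] <= 0)%E.

Definition wealth (V : R) (H : nat -> T -> R) (j n : nat) (S : T) : R :=
  V + \sum_(j <= i < n) H i S * (val S i.+1 - val S i).

(* A portfolio at (S, j) is a sequence (H_i)_{i >= j} of functions on node S j.
   It is encoded by a total H : nat -> T -> R whose values at indices i < j and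
   outside node S j carry no information; pf_ext makes membership in P S j
   independent of these values. *)
Record portfolio_axioms (P : T -> nat -> set (nat -> T -> R)) : Prop := {
  pf_ext : forall S j (H G : nat -> T -> R), P S j H ->
    (forall i x, (j <= i)%N -> node S j x -> G i x = H i x) -> P S j G;
  pf_node : forall S S' j, node S j S' -> P S' j = P S j;
  pf_nonanticipative : forall S j (H : nat -> T -> R), P S j H ->
    forall i x y, (j <= i)%N -> node S j x -> node S j y ->
    (forall k, (j <= k <= i)%N -> val x k = val y k) -> H i x = H i y;
  pf_cone : forall S j (a : R) (H G : nat -> T -> R), 0 <= a ->
    P S j H -> P S j G -> P S j (fun i x => a * H i x + G i x);
  pf_const : forall S j (H : nat -> T -> R),
    (forall i, (j <= i)%N -> exists c : R, [\/ c = -1, c = 0 | c = 1] /\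
      forall x, node S j x -> H i x = c) -> P S j H;
  pf_restrict : forall S j k (H : nat -> T -> R), (j <= k)%N ->
    P S j H -> P S k H;
  pf_stop : forall S j k (H : nat -> T -> R), (j <= k)%N ->
    P S j H -> P S j (fun i x => if (i <= k)%N then H i x else 0)
}.

Section Integrals.
Variable P : T -> nat -> set (nat -> T -> R).

(* The restriction of f to node S j is an elementary function with initial
   value V. *)
Definition elementary (S : T) (j : nat) (V : R) (f : T -> R) : Prop :=
  exists (H : nat -> T -> R) (n : nat), [/\ P S j H, (j <= n)%N &
    forall x, node S j x -> f x = wealth V H j n x].

Definition elementary_ge0 (S : T) (j : nat) (V : R) (f : T -> R) : Prop :=
  elementary S j V f /\ forall x, node S j x -> 0 <= f x.

Definition Dplus (j : nat) : set (T -> R) :=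
  [set f | (forall S, exists V, elementary S j V f) /\ forall x, 0 <= f x].

(* The initial value is unique on f in Dplus j under local 0-neutrality; the
   default 0 is only used when there is none. *)
Definition I_ (j : nat) (f : T -> R) (S : T) : R :=
  xget 0 [set V | elementary S j V f].

Definition Ibar (j : nat) (f : T -> \bar R) (S : T) : \bar R :=
  ereal_inf [set c | exists (g : nat -> T -> R) (V : nat -> R),
    [/\ forall m, elementary_ge0 S j (V m) (g m),
        forall x, node S j x -> (f x <= \sum_(0 <= m <oo) (g m x)%:E)%E &
        c = (\sum_(0 <= m <oo) (V m)%:E)%E]].

Definition cnorm (j : nat) (f : T -> \bar R) (S : T) : \bar R :=
  Ibar j (fun x => `|f x|%E) S.

(* For j = 0 the norm does not depend on S. *)
Definition null (E : set T) : Prop :=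
  forall S, cnorm 0 (fun x => (\1_E x)%:E) S = 0%E.

Definition ae (p : T -> Prop) : Prop := null [set x | ~ p x].

Definition ae_node (S : T) (j : nat) (p : T -> Prop) : Prop :=
  cnorm j (fun x => (\1_[set y | node S j y /\ ~ p y] x)%:E) S = 0%E.

(* The term g 0 is the opposite of a non-negative elementary function, and V 0
   the opposite of the initial value of the latter. *)
Definition sigma_up (j : nat) (f : T -> \bar R) (S : T) : \bar R :=
  ereal_inf [set c | exists (g : nat -> T -> R) (V : nat -> R),
    [/\ elementary_ge0 S j (- V 0%N) (fun x => - g 0%N x),
        forall m, (1 <= m)%N -> elementary_ge0 S j (V m) (g m),
        forall x, node S j x -> (f x <= \sum_(0 <= m <oo) (g m x)%:E)%E &
        c = (\sum_(0 <= m <oo) (V m)%:E)%E]].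

Definition sigma_low (j : nat) (f : T -> \bar R) (S : T) : \bar R :=
  (- sigma_up j (fun x => - f x) S)%E.

(* Differences of extended reals use the dual addition (scope dE), for which
   +oo + -oo = +oo. *)
Definition Lsigma (j : nat) : set (T -> \bar R) :=
  [set f | ae (fun S => (sigma_up j f S - sigma_low j f S)%dE = 0%E)].

Definition Lsigma_plus (j : nat) : set (T -> \bar R) :=
  [set f | Lsigma j f /\ forall x, (0 <= f x)%E].

Definition Mclass (j : nat) (S : T) : set (T -> \bar R) :=
  [set v | exists f : nat -> T -> R,
    [/\ forall m, Dplus j (f m),
        forall x, v x = (\sum_(0 <= m <oo) (f m x)%:E)%E &
        (\sum_(0 <= m <oo) (I_ j (f m) S)%:E < +oo)%E]].

Definition Lclass (j : nat) : set (T -> \bar R) :=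
  [set f | (forall x, (0 <= f x)%E) /\
    ae (fun S => forall eps : R, 0 < eps ->
      exists u v : T -> \bar R,
        [/\ Mclass j S u, Mclass j S v,
            ae_node S j (fun x => f x = (v x - u x)%dE) &
            (Ibar j u S <= eps%:E)%E])].

End Integrals.
End Trajectories.

(* Main.v *)
Require Import Defs.
From mathcomp Require Import all_boot all_order all_algebra.
From mathcomp Require Import all_classical all_reals all_analysis.
From mathcomp Require Import lra.
Import Order.TTheory GRing.Theory Num.Theory.
Import numFieldNormedType.Exports.

(** The statement is proved trajectory by trajectory: at every S where the
    defining condition of Lclass holds, the lower integral, the upper integral
    and Ibar of f agree and are finite; the exceptional set is then contained
    in the null set given by Lclass.

    At such an S, sigma_low f <= sigma_up f <= Ibar f holds for every f.  The
    first inequality (sigma_low_le_up) is the assumption that the upper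
    integral of 0 vanishes, since the sum of a superhedge of f and one of - f
    is a superhedge of 0; for the second (sigma_up_le_Ibar) the non-positive
    term is taken to be 0.

    The remaining inequality Ibar f <= sigma_low f uses f = v - u, with
    v = sum_m h_m, A = sum_m I(h_m) < oo and Ibar u small.  On the one hand
    f <= v off a null set, hence Ibar f <= A (Ibar_le_series).  On the other
    hand - f = u - v <= u - sum_(m < n) h_m, where the finite sum is a single
    elementary function and its opposite may thus serve as the non-positive
    term of the upper integral; so - f is superhedged at a price arbitrarily close to
    Ibar u - sum_(m < n) I(h_m), and letting n grow gives
    A <= sigma_low f + Ibar u (series_le_sigma_low).

    Null sets are absorbed by null_cover: if Ibar of an indicator is zero, the
    function equal to +oo on the set and 0 elsewhere has covers of arbitrarily
    small price, because countably many covers can be merged into one. *)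

Local Open Scope classical_set_scope.
Local Open Scope ring_scope.

(** * Series of extended reals *)

Lemma eseries_head {R : realType} (F : nat -> \bar R) :
  F 0%N \is a fin_num -> (forall m, (0 <= F m.+1)%E) ->
  (\sum_(0 <= m <oo) F m = F 0%N + \sum_(0 <= m <oo) F m.+1)%E.
Proof.
move=> F0 Fge0.
have cvgF : cvgn (fun n => (\sum_(0 <= m < n) F m.+1)%E).
  by apply: is_cvg_nneseries => m _ _.
apply: cvg_lim => //; rewrite -cvg_shiftS /=.
have -> : (fun n => \sum_(0 <= m < n.+1) F m)%E =
          (fun n => F 0%N + \sum_(0 <= m < n) F m.+1)%E.
  by apply/funext => n; rewrite big_nat_recl.
apply: cvgeD => //; last exact: cvg_cst.
by rewrite fin_num_adde_defr.
Qed.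

Lemma eseries_finite {R : realType} (F : nat -> \bar R) N :
  (forall m, (N <= m)%N -> F m = 0%E) ->
  (\sum_(0 <= m <oo) F m = \sum_(0 <= m < N) F m)%E.
Proof.
move=> F0; apply: lim_near_cst => //; exists N => // n /= Nn.
rewrite (big_cat_nat (n := N))//= [X in (_ + X)%E = _]big_nat.
rewrite [X in (_ + X)%E = _]big1 ?adde0//.
by move=> i /andP[Ni _]; exact: F0.
Qed.

(** The enumeration e is chosen before the family a because a doubly indexed
    family of portfolios must be reindexed in the same way as its initial
    values. *)
Lemma nneseries_pairs {R : realType} : exists e : nat -> nat * nat,
  forall a : nat -> nat -> \bar R, (forall k m, (0 <= a k m)%E) ->
  (\sum_(0 <= n <oo) a (e n).1 (e n).2 =
   \sum_(0 <= k <oo) \sum_(0 <= m <oo) a k m)%E.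
Proof.
have /card_esym/ppcard_eqP[e] := card_nat2.
exists e => a a0.
rewrite [RHS]nneseries_esumT; last by move=> k; exact: nneseries_ge0.
rewrite nneseries_esumT//; under [RHS]eq_esum do rewrite nneseries_esumT//.
rewrite esum_esum// (reindex_esum setT _ e)//.
split=> //= -[k m] _; exists (e^-1%FUN (k, m)) => //; by rewrite invK ?inE.
Qed.

Lemma nneseries_cst_pinfty {R : realType} (c : R) : 0 < c ->
  (\sum_(0 <= k <oo) c%:E = +oo)%E.
Proof.
move=> c0; apply/eqP; rewrite eq_le leey /= leNgt.
apply/negP => slt.
(* A finite sum s would satisfy s = c + s. *)
have sfin : (\sum_(0 <= k <oo) c%:E)%E \is a fin_num.
  by rewrite ge0_fin_numE// nneseries_ge0// => *; rewrite lee_fin ltW.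
have := @eseries_head _ (fun=> c%:E) isT (fun=> ltW c0).
by case: (limn _) sfin => // s _ [] sE; lra.
Qed.

(** * Elementary functions *)

Section Node.
Set Implicit Arguments.
Unset Strict Implicit.
Context {R : realType} {T : set (nat -> R)} {P : T -> nat -> set (nat -> T -> R)}.
Context (P_axioms : portfolio_axioms P).
Implicit Types (S : T) (j : nat).

(** Stopping the portfolio after the maturity makes the maturity irrelevant, so
    that two elementary functions can be given a common one.  When the maturity
    is j itself nothing is traded and the zero portfolio is used, as stopping
    keeps at least the position at time j. *)
Lemma elementary_stopped S j V f : elementary P S j V f ->
  exists H n, P S j H /\ forall n', (n <= n')%N ->
    forall x, node S j x -> f x = wealth V H j n' x.
Proof.
case=> H [n [PH jn fE]].
have [nj|] := leqP n j.
  exists (fun _ _ => 0), j; split.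
    by apply: (pf_const P_axioms) => i _; exists 0; split => //; apply: Or32.
  move=> n' jn' x Sx; rewrite fE// /wealth.
  by rewrite big_geq// big1// => i _; rewrite mul0r.
case: n jn fE => // n jn fE jn'.
exists (fun i x => if (i <= n)%N then H i x else 0), n.+1; split.
  exact: (pf_stop P_axioms).
move=> n' nn' x Sx; rewrite fE// /wealth; congr (_ + _).
rewrite [RHS](big_cat_nat (n := n.+1))//=.
rewrite [X in _ = _ + X]big_nat [X in _ = _ + X]big1 ?addr0.
  by rewrite !big_nat; apply: eq_bigr => i /andP[_]; rewrite ltnS => ->.
by move=> i /andP[ni _]; rewrite leqNgt ni /= mul0r.
Qed.

Lemma elementaryD S j V W f g : elementary P S j V f -> elementary P S j W g ->
  elementary P S j (V + W) (fun x => f x + g x).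
Proof.
move=> /elementary_stopped[H [n [PH fE]]] /elementary_stopped[G [n' [PG gE]]].
exists (fun i x => 1 * H i x + G i x), (maxn j (maxn n n')); split.
- exact: (pf_cone P_axioms).
- exact: leq_maxl.
- move=> x Sx; rewrite (fE (maxn j (maxn n n')))//; last first.
    by rewrite !leq_max leqnn orbT.
  rewrite (gE (maxn j (maxn n n')))//; last by rewrite !leq_max leqnn !orbT.
  rewrite /wealth addrACA -big_split /=; congr (_ + _).
  by apply: eq_bigr => i _; rewrite mul1r mulrDl.
Qed.

Lemma elementary_ge0D S j V W f g :
  elementary_ge0 P S j V f -> elementary_ge0 P S j W g ->
  elementary_ge0 P S j (V + W) (fun x => f x + g x).
Proof.
move=> [Vf f0] [Wg g0]; split; first exact: elementaryD.
by move=> x Sx; rewrite addr_ge0 ?f0 ?g0.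
Qed.

Lemma elementary_ge0_0 S j : elementary_ge0 P S j 0 (fun=> 0).
Proof.
split=> //; exists (fun _ _ => 0), j; split=> //.
  by apply: (pf_const P_axioms) => i _; exists 0; split => //; apply: Or32.
by move=> x _; rewrite /wealth big_geq// addr0.
Qed.

Lemma elementary_ge0_sum S j (V : nat -> R) (f : nat -> T -> R) N :
  (forall m, elementary_ge0 P S j (V m) (f m)) ->
  elementary_ge0 P S j (\sum_(0 <= m < N) V m)
    (fun x => \sum_(0 <= m < N) f m x).
Proof.
move=> Vf; elim: N => [|N IH].
  rewrite big_nil; under eq_fun do rewrite big_nil.
  exact: elementary_ge0_0.
rewrite big_nat_recr//=.
have -> : (fun x => \sum_(0 <= m < N.+1) f m x) =
          (fun x => \sum_(0 <= m < N) f m x + f N x).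
  by apply/funext => x; rewrite big_nat_recr.
exact: elementary_ge0D.
Qed.

(** * Countable superhedges *)

(** The prices c over which Ibar is the infimum. *)
Definition cover S j (f : T -> \bar R) (c : \bar R) : Prop :=
  exists (g : nat -> T -> R) (V : nat -> R),
    [/\ forall m, elementary_ge0 P S j (V m) (g m),
        forall x, node S j x -> (f x <= \sum_(0 <= m <oo) (g m x)%:E)%E &
        c = (\sum_(0 <= m <oo) (V m)%:E)%E].

Lemma Ibar_le_cover S j f c : cover S j f c -> (Ibar P j f S <= c)%E.
Proof. by move=> fc; apply: ereal_inf_lbound. Qed.

Lemma Ibar_lt_cover S j f b : (Ibar P j f S < b)%E ->
  exists2 c, cover S j f c & (c < b)%E.
Proof. by move=> /ereal_inf_lt[c fc cb]; exists c. Qed.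

Lemma cover_le S j f f' c : (forall x, node S j x -> (f x <= f' x)%E) ->
  cover S j f' c -> cover S j f c.
Proof.
move=> ff' [g [V [Vg f'g cE]]]; exists g, V; split=> // x Sx.
exact: le_trans (ff' _ Sx) (f'g _ Sx).
Qed.

Lemma cover_max0 S j f c : cover S j f c ->
  cover S j (fun x => maxe (f x) 0%E) c.
Proof.
move=> [g [V [Vg fg cE]]]; exists g, V; split=> // x Sx.
rewrite ge_max fg//= nneseries_ge0// => m _ _.
by rewrite lee_fin; exact: (Vg m).2.
Qed.

Section Sigma.
Context {j : nat} (sigma0 : forall S : T, sigma_up P j (fun=> 0%E) S = 0%E).

(** A non-negative elementary function superhedges 0, so its initial value
    bounds the upper integral of 0 from above. *)
Lemma initial_ge0 S V g : elementary_ge0 P S j V g -> 0 <= V.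
Proof.
move=> Vg.
suff : (sigma_up P j (fun=> 0) S <= V%:E)%E by rewrite sigma0 lee_fin.
(* Index 0 is reserved for the non-positive term, so g is placed at index 1. *)
have put1 (a : R) : (\sum_(0 <= m <oo) (if m == 1%N then a else 0)%:E = a%:E)%E.
  rewrite (@eseries_finite _ _ 2%N); first by rewrite !big_nat_recr//= big_nil !add0e.
  by move=> [|[|m]].
apply: ereal_inf_lbound; exists (fun m x => if m == 1%N then g x else 0).
exists (fun m => if m == 1%N then V else 0); split.
- by rewrite /= oppr0; exact: elementary_ge0_0.
- by move=> [|[|m]]//= _; exact: elementary_ge0_0.
- by move=> x Sx; rewrite put1 lee_fin; exact: Vg.2.
- by rewrite put1.
Qed.

Lemma cover_ge0 S f c : cover S j f c -> (0 <= c)%E.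
Proof.
move=> [g [V [Vg _ ->]]]; apply: nneseries_ge0 => m _ _.
by rewrite lee_fin; exact: initial_ge0 (Vg m).
Qed.

Lemma Ibar_ge0 S f : (0 <= Ibar P j f S)%E.
Proof. by apply: le_ereal_inf_tmp => c; exact: cover_ge0. Qed.

Lemma coverD S f f' c c' : cover S j f c -> cover S j f' c' ->
  cover S j (fun x => f x + f' x)%E (c + c')%E.
Proof.
move=> [g [V [Vg fg ->]]] [g' [V' [Vg' fg' ->]]].
exists (fun m x => g m x + g' m x), (fun m => V m + V' m); split.
- by move=> m; exact: elementary_ge0D.
- move=> x Sx; under eq_eseriesr do rewrite EFinD.
  rewrite nneseriesD; first exact: leeD (fg _ Sx) (fg' _ Sx).
    by move=> m _ _; rewrite lee_fin; exact: (Vg m).2.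
  by move=> m _ _; rewrite lee_fin; exact: (Vg' m).2.
- under [RHS]eq_eseriesr do rewrite EFinD.
  rewrite nneseriesD// => m _ _; rewrite lee_fin.
    exact: initial_ge0 (Vg m).
  exact: initial_ge0 (Vg' m).
Qed.

Lemma cover_series S (f : nat -> T -> \bar R) (c : nat -> \bar R) :
  (forall k x, 0 <= f k x)%E -> (forall k, cover S j (f k) (c k)) ->
  cover S j (fun x => \sum_(0 <= k <oo) f k x)%E (\sum_(0 <= k <oo) c k)%E.
Proof.
move=> f0 /choice[g] /choice[V gV].
have gE k : (forall m, elementary_ge0 P S j (V k m) (g k m)) by have [] := gV k.
have [e eE] := @nneseries_pairs R.
exists (fun n => g (e n).1 (e n).2), (fun n => V (e n).1 (e n).2); split.
- by move=> n.
- move=> x Sx; rewrite (eE (fun k m => (g k m x)%:E)); last first.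
    by move=> k m; rewrite lee_fin; exact: (gE k m).2.
  by apply: lee_nneseries => // k _; have [_ + _] := gV k; exact.
- rewrite (eE (fun k m => (V k m)%:E)); last first.
    by move=> k m; rewrite lee_fin; exact: initial_ge0 (gE k m).
  by apply: eq_eseriesr => k _; have [] := gV k.
Qed.

(** The set E is covered once for each k, at price d / 2 ^ (k + 1): the merged
    cover has price at most d, and its sum on E is a sum of infinitely many
    ones. *)
Lemma null_cover S (E : set T) (d : R) : 0 < d ->
  Ibar P j (fun x => (\1_E x)%:E) S = 0%E ->
  exists2 c, cover S j (fun x => if x \in E then +oo else 0)%E c & (c <= d%:E)%E.
Proof.
move=> d0 E0.
have /choice[c ccov] : forall k, exists c, cover S j (fun x => (\1_E x)%:E) c /\
    (c <= (d / (2 ^ k.+1)%:R)%:E)%E.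
  move=> k; have dk : (0 < (d / (2 ^ k.+1)%:R)%:E)%E.
    by rewrite lte_fin divr_gt0// ltr0n expn_gt0.
  have [c ? /ltW ?] : exists2 c, cover S j (fun x => (\1_E x)%:E) c &
      (c < (d / (2 ^ k.+1)%:R)%:E)%E by apply: Ibar_lt_cover; rewrite E0.
  by exists c.
exists (\sum_(0 <= k <oo) c k)%E.
  apply: (cover_le (f' := fun x => (\sum_(0 <= k <oo) (\1_E x)%:E)%E)).
    move=> x _; rewrite indicE; case: (x \in E); first by rewrite nneseries_cst_pinfty.
    by rewrite nneseries_ge0.
  apply: cover_series => [k x|k]; last exact: (ccov k).1.
  by rewrite lee_fin.
apply: le_trans (epsilon_trick0 _ (ltW d0)).
apply: lee_nneseries => [k _ _|k _]; last exact: (ccov k).2.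
exact: cover_ge0 (ccov k).1.
Qed.

(** * Comparison of the integrals *)

(** Separating the non-positive term - g0 from the series leaves an ordinary
    cover, of f + g0 instead of f. *)
Lemma sigma_upE S f : sigma_up P j f S = ereal_inf [set a | exists V0 g0 c,
  [/\ elementary_ge0 P S j V0 g0, cover S j (fun x => f x + (g0 x)%:E)%E c &
      a = ((- V0)%:E + c)%E]].
Proof.
congr ereal_inf; apply/seteqP; split=> a /=.
  move=> [g [V [Vg0 Vg fg ->]]]; exists (- V 0%N), (fun x => - g 0%N x).
  exists (\sum_(0 <= m <oo) (V m.+1)%:E)%E; split=> //.
    exists (fun m => g m.+1), (fun m => V m.+1); split=> // [m|x Sx].
      exact: Vg.
    rewrite EFinN leeBlDl// -(@eseries_head _ (fun m => (g m x)%:E))//; first exact: fg.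
    by move=> m; rewrite lee_fin; exact: (Vg m.+1 isT).2.
  rewrite opprK -(@eseries_head _ (fun m => (V m)%:E))// => m.
  by rewrite lee_fin; exact: initial_ge0 (Vg m.+1 isT).
move=> [V0 [g0 [c [Vg0 [g [V [Vg fg ->]]] ->]]]].
exists (fun m x => if m is m'.+1 then g m' x else - g0 x).
exists (fun m => if m is m'.+1 then V m' else - V0); split=> /=.
- rewrite opprK; have -> : (fun x => - - g0 x) = g0 by apply/funext => x; rewrite opprK.
  exact: Vg0.
- by case.
- move=> x Sx; rewrite eseries_head//=; last first.
    by move=> m; rewrite lee_fin; exact: (Vg m).2.
  by rewrite EFinN addeC leeBrDr// fg.
- rewrite [RHS]eseries_head//= => m.
  by rewrite lee_fin; exact: initial_ge0 (Vg m).
Qed.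

Lemma sigma_up_le_cover S f V0 g0 c : elementary_ge0 P S j V0 g0 ->
  cover S j (fun x => f x + (g0 x)%:E)%E c ->
  (sigma_up P j f S <= (- V0)%:E + c)%E.
Proof.
by move=> Vg0 fc; rewrite sigma_upE; apply: ereal_inf_lbound; exists V0, g0, c.
Qed.

Lemma sigma_up_le_Ibar S f : (sigma_up P j f S <= Ibar P j f S)%E.
Proof.
apply: le_ereal_inf_tmp => c fc.
rewrite -[c]add0e -[0%E]/(0%:E) -oppr0.
apply: sigma_up_le_cover (elementary_ge0_0 S j) _.
by apply: cover_le fc => x _; rewrite adde0.
Qed.

(** Adding a superhedge of f to one of - f gives a superhedge of 0, which has
    a non-negative price. *)
Lemma sigma_low_le_up S f : (sigma_low P j f S <= sigma_up P j f S)%E.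
Proof.
rewrite [leRHS]sigma_upE; apply: le_ereal_inf_tmp => a [V [g [c [Vg fc ->]]]].
rewrite /sigma_low leeNl sigma_upE.
apply: le_ereal_inf_tmp => b [V' [g' [c' [Vg' fc' ->]]]].
have : (sigma_up P j (fun=> 0) S <= (- (V + V'))%:E + (c + c'))%E.
  apply: sigma_up_le_cover (elementary_ge0D Vg Vg') _.
  (* Where f is infinite, f + (- f) is -oo and the sum of the two covered
     functions bounds nothing; their positive parts, dominated by the
     same series, sum to +oo there. *)
  apply: cover_le (coverD (cover_max0 fc) (cover_max0 fc')) => x Sx.
  rewrite add0e EFinD.
  have le_maxl (y z : \bar R) : (y <= maxe y z)%E by rewrite le_max lexx.
  have max0_ge0 (y : \bar R) : (0 <= maxe y 0)%E by rewrite le_max lexx orbT.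
  case: (f x) => [r||]/=.
  - apply: le_trans (leeD (le_maxl _ _) (le_maxl _ _)).
    by rewrite -!EFinD lee_fin; lra.
  - by rewrite maxye addye ?leey// gt_eqF// (lt_le_trans _ (max0_ge0 _)).
  - rewrite [(+oo + _)%E]addye// maxye addey ?leey// gt_eqF//.
    exact: lt_le_trans (max0_ge0 _).
rewrite sigma0; have := cover_ge0 fc; have := cover_ge0 fc'.
case: c {fc} => [c||]//; case: c' {fc'} => [c'||]// _ _.
- by rewrite -!EFinD !lee_fin; lra.
- by rewrite [leRHS]addey ?leey.
- by rewrite (@addey _ (- V)%:E)// leNye.
Qed.

(** * Decomposable functions *)

Section Decomposition.
Context (S : T) (h : nat -> T -> R) (f u : T -> \bar R).
Let A := (\sum_(0 <= m <oo) (I_ P j (h m) S)%:E)%E.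
Let v x := (\sum_(0 <= m <oo) (h m x)%:E)%E.
Context (hD : forall m, Dplus P j (h m)) (f0 : forall x, (0 <= f x)%E)
  (u0 : forall x, (0 <= u x)%E)
  (fE : ae_node P S j (fun x => f x = (v x - u x)%dE)).
Let N := [set y | node S j y /\ ~ f y = (v y - u y)%dE].

Let hE m : elementary_ge0 P S j (I_ P j (h m) S) (h m).
Proof.
have [hel hpos] := hD m; split; last by move=> x _; exact: hpos.
have [V Vh] := hel S.
exact: (xgetI (P := [set V | elementary P S j V (h m)]) 0 Vh).
Qed.

Let N0 : Ibar P j (fun x => (\1_N x)%:E) S = 0%E.
Proof.
rewrite -fE /cnorm; congr Ibar; apply/funext => x /=.
by rewrite ger0_norm.
Qed.

(** Off N one has f = v - u <= v, and the terms h_m are a cover of v at price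
    A; the set N costs at most d more. *)
Lemma Ibar_le_series : (Ibar P j f S <= A)%E.
Proof.
apply/lee_addgt0Pr => d d0.
have [c Nc cd] := null_cover d0 N0.
apply: le_trans (leeD2l A cd); apply: Ibar_le_cover.
have vA : cover S j v A by exists h, (fun m => I_ P j (h m) S).
have v0 x : (0 <= v x)%E.
  by apply: nneseries_ge0 => m _ _; rewrite lee_fin; exact: (hD m).2.
apply: cover_le (coverD vA Nc) => x Sx; have [xN|xN] := boolP (x \in N).
  by rewrite addey ?leey// -ltNye (lt_le_trans _ (v0 x)).
rewrite adde0; have /contrapT -> : ~ ~ f x = (v x - u x)%dE.
  by move=> fx; case/negP: xN; rewrite inE.
have := v0 x; have := u0 x.
case: (v x) (u x) => [r||] [s||]//=; rewrite ?leey// !lee_fin => s0 r0.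
- by change ((r - s)%:E <= r%:E)%E; rewrite lee_fin; lra.
- exact: leNye.
Qed.

(** For each n, the opposite of the partial sum of v is used as the
    non-positive term in a superhedge of - f; the rest, at most u off N, is
    superhedged at price at most b + d. *)
Lemma series_le_sigma_low (b d : R) : (Ibar P j u S < b%:E)%E -> 0 < d ->
  (A <= sigma_low P j f S + (b + d)%:E)%E.
Proof.
move=> ub d0; have [c uc cb] := Ibar_lt_cover ub.
have [c' Nc cd] := null_cover d0 N0.
apply: lime_le.
  by apply: is_cvg_nneseries => m _ _; rewrite lee_fin; exact: initial_ge0 (hE m).
apply: nearW => n; rewrite sumEFin.
have : (sigma_up P j (fun x => - f x) S <=
    (- \sum_(0 <= m < n) I_ P j (h m) S)%:E + (c + c'))%E.
  apply: sigma_up_le_cover (elementary_ge0_sum n hE) _.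
  apply: cover_le (coverD uc Nc) => x Sx; have [xN|xN] := boolP (x \in N).
    by rewrite addey ?leey// -ltNye (lt_le_trans _ (u0 x)).
  have : f x = (v x - u x)%dE.
    by apply: contrapT => fx; case/negP: xN; rewrite inE.
  have : ((\sum_(0 <= m < n) h m x)%:E <= v x)%E.
    rewrite -sumEFin; apply: nneseries_lim_ge => m _ _.
    by rewrite lee_fin; exact: (hD m).2.
  rewrite adde0; have := f0 x; have := u0 x.
  case: (f x) (v x) (u x) => [q||] [r||] [s||]//= _ _.
  - by change (r%:E - s%:E)%dE with (r - s)%:E => + [->]; rewrite -EFinD !lee_fin; lra.
  - by move=> _ _; exact: leNye.
move=> /le_trans /(_ (leeD (lexx _) (leeD (ltW cb) cd))).
rewrite /sigma_low -!EFinD; case: (sigma_up _ _ _ _) => [s||]//=.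
- by rewrite -?EFinD !lee_fin; lra.
- by move=> _; exact: leey.
Qed.
End Decomposition.

Lemma Mclass_ge0 S u : Mclass P j S u -> forall x, (0 <= u x)%E.
Proof.
move=> [g [gD uE _]] x; rewrite uE; apply: nneseries_ge0 => m _ _.
by rewrite lee_fin; exact: (gD m).2.
Qed.

Lemma Lclass_sandwich S f : (forall x, (0 <= f x)%E) ->
  (forall eps : R, 0 < eps -> exists u v : T -> \bar R,
        [/\ Mclass P j S u, Mclass P j S v,
            ae_node P S j (fun x => f x = (v x - u x)%dE) &
            (Ibar P j u S <= eps%:E)%E]) ->
  [/\ sigma_low P j f S = Ibar P j f S, sigma_up P j f S = Ibar P j f S &
      Ibar P j f S \is a fin_num].
Proof.
move=> f0 fuv.
have Ilow : (Ibar P j f S <= sigma_low P j f S)%E.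
  apply/lee_addgt0Pr => e e0.
  have e4 : 0 < e / 4 by rewrite divr_gt0.
  have [u [v [/Mclass_ge0 u0 [h [hD /funext -> _]] fE ue]]] := fuv _ e4.
  apply: le_trans (Ibar_le_series hD u0 fE) _.
  have -> : e = e / 2 + e / 2 by rewrite -splitr.
  apply: (series_le_sigma_low hD f0 u0 fE); last by rewrite divr_gt0.
  by apply: le_lt_trans ue _; rewrite lte_fin; lra.
have lowI := le_trans (sigma_low_le_up S f) (sigma_up_le_Ibar S f).
split.
- by apply/eqP; rewrite eq_le lowI.
- apply/eqP; rewrite eq_le sigma_up_le_Ibar/=.
  exact: le_trans Ilow (sigma_low_le_up S f).
- have [u [v [/Mclass_ge0 u0 [h [hD /funext -> Aoo]] fE ue]]] := fuv 1 ltr01.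
  rewrite ge0_fin_numE ?Ibar_ge0//.
  exact: le_lt_trans (Ibar_le_series hD u0 fE) Aoo.
Qed.

End Sigma.

(** * Almost everywhere statements *)

Lemma ae_sub (sigma0 : forall S : T, sigma_up P 0 (fun=> 0%E) S = 0%E)
    (p q : T -> Prop) :
  (forall S, p S -> q S) -> ae P p -> ae P q.
Proof.
move=> pq p0 S; apply/eqP; rewrite eq_le (Ibar_ge0 sigma0) andbT -(p0 S).
apply: le_ereal_inf_tmp => c pc; apply: Ibar_le_cover; apply: cover_le pc => x _ /=.
rewrite !ger0_norm// lee_fin !indicE ler_nat.
case: (boolP (x \in [set y | ~ q y])) => //; rewrite inE/= => nq.
by have -> : x \in [set y | ~ p y] by rewrite inE/= => /pq.
Qed.
End Node.

Theorem corollary4 (R : realType) (s0 : R) (T : set (nat -> R))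
  (T_nonempty : T !=set0) (T_start : forall S : T, val S 0%N = s0)
  (P : T -> nat -> set (nat -> T -> R)) (P_axioms : portfolio_axioms P)
  (neutral : @locally_neutral R T)
  (sigma0 : forall (j : nat) (S : T), sigma_up P j (fun _ => 0%E) S = 0%E)
  (j : nat) :
  (forall f : T -> \bar R, Lclass P j f ->
     ae P (fun S => sigma_low P j f S = sigma_up P j f S /\
                    sigma_up P j f S = Ibar P j f S)) /\
  Lclass P j `<=` Lsigma_plus P j.
Proof.
have sandwich f : Lclass P j f -> ae P (fun S =>
    [/\ sigma_low P j f S = Ibar P j f S, sigma_up P j f S = Ibar P j f S &
      Ibar P j f S \is a fin_num]).
  move=> [f0]; apply: (ae_sub P_axioms (sigma0 0%N)) => S.
  exact: (Lclass_sandwich P_axioms (sigma0 j)).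
split=> [f /sandwich|f Lf].
  by apply: (ae_sub P_axioms (sigma0 0%N)) => S [-> ->].
split; last exact: Lf.1.
move: (sandwich f Lf); apply: (ae_sub P_axioms (sigma0 0%N)) => S [-> -> Ifin].
by rewrite DualAddTheoryNumDomain.dsubee.
Qed.
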